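(* Let $\mathcal{G}(\mathcal{I},J_i,\Omega_i)$ be an $N$-player game with $\Omega_i=\mathbb{R}^{n_i}$ for every $i\in\mathcal{I}=\{1,\dots,N\}$, played over an undirected communication graph $G_c=(\mathcal{I},E)$. Assume: (1) $G_c$ is connected; (2) for every $i\in\mathcal{I}$, $J_i:\Omega\to\mathbb{R}$ is $\mathcal{C}^2$ in its arguments, and strictly convex and radially unbounded in $x_i$ for every $x_{-i}\in\Omega_{-i}$; (3) the pseudo-gradient $F$ is strictly monotone: $(x-x')^T(F(x)-F(x'))>0$ for all $x\neq x'$ in $\Omega$; (4) the extended pseudo-gradient $\mathbf{F}$ is monotone in the sense that $(\mathcal{R}\mathbf{x}-\mathcal{R}\mathbf{x}')^T(\mathbf{F}(\mathbf{x})-\mathbf{F}(\mathbf{x}'))\ge 0$ for all $\mathbf{x},\mathbf{x}'\in\Omega^N=\mathbb{R}^{Nn}$. Let $x^*$ denote the Nash equilibrium of the game. Let each player's dynamics be $$\dot{\mathbf{x}}^i=-\mathcal{R}_i^T\nabla_iJ_i(\mathbf{x}^i)-\sum_{j\in\mathcal{N}_i}(\mathbf{x}^i-\mathbf{x}^j),\qquad i\in\mathcal{I},$$ equivalently, in stacked form, $\dot{\mathbf{x}}=-\mathcal{R}^T\mathbf{F}(\mathbf{x})-\mathbf{L}\mathbf{x}$. Then any solution of this system is bounded and asymptotically converges to $\mathbf{1}_N\otimes x^*$, and the action components $\mathcal{R}\mathbf{x}$ converge to the Nash equilibrium $x^*$ of the game.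
   Context: Game: players $\mathcal{I}=\{1,\dots,N\}$; player $i$ has action $x_i\in\Omega_i\subseteq\mathbb{R}^{n_i}$; $\Omega=\prod_i\Omega_i\subseteq\mathbb{R}^n$, $n=\sum_i n_i$, $\Omega_{-i}=\prod_{j\ne i}\Omega_j$; $x=(x_i,x_{-i})\in\Omega$ is the (stacked) action profile; player $i$ minimizes $J_i(x_i,x_{-i})$, $J_i:\Omega\to\mathbb{R}$. A Nash equilibrium is $x^*\in\Omega$ with $J_i(x_i^*,x_{-i}^* )\le J_i(y_i,x_{-i}^* )$ for all $i$ and all $y_i\in\Omega_i$. Under the assumptions of the claim the game is taken to have a unique Nash equilibrium $x^*$. Gradients: $\nabla_iJ_i(x)=\frac{\partial J_i}{\partial x_i}(x)\in\mathbb{R}^{n_i}$; the pseudo-gradient is $F(x)=[\nabla_1J_1(x)^T,\dots,\nabla_NJ_N(x)^T]^T$. Estimates: player $i$ holds $\mathbf{x}^i=[(\mathbf{x}^i_1)^T,\dots,(\mathbf{x}^i_N)^T]^T\in\mathbb{R}^n$, where $\mathbf{x}^i_j$ is its estimate of player $j$'s action and $\mathbf{x}^i_i=x_i$ is its own actual action. $\mathbf{x}=[(\mathbf{x}^1)^T,\dots,(\mathbf{x}^N)^T]^T\in\Omega^N=\mathbb{R}^{Nn}$. The extended pseudo-gradient is $\mathbf{F}(\mathbf{x})=[\nabla_1J_1(\mathbf{x}^1)^T,\dots,\nabla_NJ_N(\mathbf{x}^N)^T]^T\in\mathbb{R}^n$. Matrices: $\mathcal{R}_i\in\mathbb{R}^{n_i\times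 n}$ selects the $i$-th block of a vector in $\mathbb{R}^n$: $\mathcal{R}_i=[\mathbf{0}\ I_{n_i}\ \mathbf{0}]$ with zero blocks of $\sum_{j<i}n_j$ and $\sum_{j>i}n_j$ columns. $\mathcal{R}=\mathrm{diag}(\mathcal{R}_1,\dots,\mathcal{R}_N)$, so $\mathcal{R}\mathbf{x}=[(\mathbf{x}^1_1)^T,\dots,(\mathbf{x}^N_N)^T]^T$ is the stacked action vector. Graph: $\mathcal{N}_i$ is the set of neighbours of $i$ in $G_c$; $L\in\mathbb{R}^{N\times N}$ is the graph Laplacian ($[L]_{ii}=|\mathcal{N}_i|$, $[L]_{ij}=-1$ if $j\in\mathcal{N}_i$, $0$ otherwise); $\mathbf{L}=L\otimes I_n$; $\mathbf{1}_N$ is the all-ones vector. *)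

(* Defs.v *)
From HB Require Import structures.
From mathcomp Require Import all_boot all_order all_algebra.
From mathcomp Require Import all_classical all_reals all_analysis.

Set Implicit Arguments.
Unset Strict Implicit.
Unset Printing Implicit Defensive.

Import Order.TTheory GRing.Theory Num.Theory.
Import numFieldNormedType.Exports.
Local Open Scope classical_set_scope.
Local Open Scope ring_scope.

Definition dot (R : realType) (n : nat) (u v : 'cV[R]_n) : R := (u^T *m v) 0 0.

Definition C1 (R : realType) (V : normedModType R) (f : V -> R) : Prop :=
  (forall x, differentiable f x) /\ forall v, continuous (fun x => 'D_v f x).

Definition C2 (R : realType) (V : normedModType R) (f : V -> R) : Prop :=
  C1 f /\ forall v, C1 (fun x => 'D_v f x).

Definition strictly_convex (R : realType) (V : lmodType R) (f : V -> R) : Prop :=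
  forall (y z : V) (t : R), y != z -> 0 < t -> t < 1 ->
    f (t *: y + (1 - t) *: z) < t * f y + (1 - t) * f z.

Definition radially_unbounded (R : realType) (V : normedModType R)
    (f : V -> R) : Prop :=
  forall M : R, exists r : R, forall y : V, r < `|y| -> M < f y.

(* The joint action space R^n, n = n_1 + ... + n_N, with n_i = d i. *)
Notation profile R d := 'cV[R]_(\sum_i d i).

(* The space R^(Nn) of stacked estimates: N blocks, each of them a profile. *)
Notation estimates R N d := 'cV[R]_(\sum_(i < N) \sum_j d j).

Section Game.
Variables (R : realType) (N : nat) (d : 'I_N -> nat).
Implicit Types (x : profile R d) (X : estimates R N d) (i : 'I_N).

Definition action x i : 'cV[R]_(d i) := submxcol x i.

Definition estimate X i : profile R d := submxcol X i.

(* The profile (y, x_{-i}). *)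
Definition deviate x i (y : 'cV[R]_(d i)) : profile R d :=
  \mxcol_j dfwith (action x) i y j.

(* R_i = [0 I 0] is the i-th block of rows of the identity. *)
Definition sel i : 'M[R]_(d i, \sum_j d j) := submxcol 1%:M i.

Lemma mul_sel i x : sel i *m x = action x i.
Proof. by rewrite /sel submxcol_mul mul1mx. Qed.

Definition bsel : 'M[R]_(\sum_i d i, \sum_(i < N) \sum_j d j) :=
  \mxblock_(i < N, j < N) ((i == j)%:R *: sel i).

Section Payoff.
Variable J : 'I_N -> profile R d -> R.

Definition nash x : Prop := forall i (y : 'cV[R]_(d i)), J i x <= J i (deviate x y).

(* Its k-th entry is the partial derivative along the k-th coordinate of the
   i-th block, i.e. along the basis vector R_i^T e_k. *)
Definition grad i x : 'cV[R]_(d i) :=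
  \col_k 'D_((sel i)^T *m delta_mx k 0) (J i) x.

Definition pseudo_grad x : profile R d := \mxcol_i grad i x.

Definition ext_pseudo_grad X : profile R d := \mxcol_i grad i (estimate X i).

Variable e : rel 'I_N.

Definition player_field X i : profile R d :=
  - ((sel i)^T *m grad i (estimate X i))
  - \sum_(j | e i j) (estimate X i - estimate X j).

(* A solution on [0, T[, where T may be +oo; at t = 0 only (right) continuity
   is required, so that nothing is assumed about X at negative times. *)
Definition lifetime (T : \bar R) : set R := [set t | 0 <= t /\ (t%:E < T)%E].

Definition solution (T : \bar R) (X : R -> estimates R N d) : Prop :=
  {within lifetime T, continuous X} /\
  forall t : R, 0 < t -> (t%:E < T)%E -> forall i,
    is_derive t 1 (fun s => estimate (X s) i) (player_field (X t) i).

Definition laplacian : 'M[R]_N :=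
  \matrix_(i, j) (if i == j then #|[set k | e i k]%SET|%:R
                  else if e i j then -1 else 0).

(* L (x) I_n, written by blocks. *)
Definition blaplacian : 'M[R]_(\sum_(i < N) \sum_j d j) :=
  \mxblock_(i < N, j < N) ((laplacian i j)%:M : 'M[R]_(\sum_k d k)).

Definition stacked_field X : estimates R N d :=
  - (bsel^T *m ext_pseudo_grad X) - blaplacian *m X.

Lemma stacked_fieldE X i : irreflexive e ->
  estimate (stacked_field X) i = player_field X i.
Proof.
move=> eI; rewrite /estimate /stacked_field submxcolB submxcolN.
congr (- _ - _).
- rewrite /bsel tr_mxblock mul_mxblock_mxrow mxcolK.
  rewrite [LHS](bigD1 i) //= eqxx scale1r [X in _ + X]big1 ?addr0 // => j jDi.
  by rewrite (negbTE jDi) scale0r trmx0 mul0mx.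
- rewrite -[in LHS](submxcolK X) mul_mxblock_mxrow mxcolK.
  have lapE j : (laplacian i j)%:M *m estimate X j =
      laplacian i j *: estimate X j by rewrite mul_scalar_mx.
  rewrite (eq_bigr _ (fun j _ => lapE j)).
  rewrite [LHS](bigD1 i)//= {1}/laplacian mxE eqxx sumrB sumr_const cardsE scaler_nat.
  congr (_ + _); rewrite [LHS]big_mkcond [X in - X]big_mkcond /= -sumrN.
  apply: eq_bigr => j _; rewrite /laplacian mxE eq_sym; case: eqP => [<-|_] /=.
    by rewrite eI oppr0.
  by case: (e i j); rewrite ?scaleN1r ?scale0r ?oppr0.
Qed.

End Payoff.
End Game.

(* Main.v *)
Require Import Defs.
From HB Require Import structures.
From mathcomp Require Import all_boot all_order all_algebra.
From mathcomp Require Import all_classical all_reals all_analysis.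
From mathcomp Require Import lra.

Set Implicit Arguments.
Unset Strict Implicit.
Unset Printing Implicit Defensive.

Import Order.TTheory GRing.Theory Num.Theory.
Import numFieldNormedType.Exports.
Local Open Scope classical_set_scope.
Local Open Scope ring_scope.

(** Put [V X = |X - \mxcol_i xs|^2].  Since [xs] is a Nash equilibrium, every
    partial gradient vanishes at [xs] ([grad_nash]).  Along a solution, half the
    derivative of [V] is therefore minus the sum of two terms ([dot_field]): the
    monotonicity form of the extended pseudo-gradient between [X] and
    [\mxcol_i xs], and the quadratic form of the graph Laplacian, which is the
    sum of [|X_i - X_j|^2] over the undirected edges.

    Both terms are nonnegative.  If both vanish, connectedness of the graph makes
    all the estimates equal to a common profile [x], on which the extended
    pseudo-gradient is the pseudo-gradient, so that strict monotonicity gives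
    [x = xs].  Hence [V] is a strict Lyapunov function: at every other point, the
    field makes the distance to [\mxcol_i xs] decrease ([field_dissipative]).

    The analytic half is about any continuous field [G] with
    [<x - x0, G x> < 0] for [x != x0].  The squared distance to [x0] does not
    increase along a solution, which bounds it ([dissipative_bounded]).  If that
    distance stayed above a positive threshold, the solution would remain in a
    compact annulus, where [<x - x0, G x>] is bounded away from [0]
    ([dissipative_gap]); the squared distance would then decrease at a uniform
    rate and become negative ([dissipative_cvg]). *)

(** * Matrix-valued limits and derivatives *)

Lemma cvg_mx (R : realType) (T : Type) (F : set_system T) (FF : Filter F)
    (m n : nat) (f : T -> 'M[R]_(m, n)) (l : 'M[R]_(m, n)) :
  (forall i j, f x i j @[x --> F] --> l i j) -> f x @[x --> F] --> l.
Proof.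
move=> fl; apply/cvgrPdist_le => /= eps eps0; near=> x.
rewrite /Num.Def.normr/= mx_normrE (bigmax_le _ (ltW eps0))//= => i _.
rewrite !mxE; move: i; near: x; apply: filter_forall => /= i.
exact: ((cvgrPdist_le _ _).1 (fl i.1 i.2)).
Unshelve. all: by end_near. Qed.

Lemma continuous_mx (R : realType) (T : topologicalType) (m n : nat)
    (f : T -> 'M[R]_(m, n)) :
  (forall i j, continuous (fun x => f x i j)) -> continuous f.
Proof. by move=> cf x; apply: cvg_mx => i j; exact: cf. Qed.

Lemma continuous_coord (R : realType) (T : topologicalType) (m n : nat)
    (f : T -> 'M[R]_(m, n)) i j :
  continuous f -> continuous (fun x => f x i j).
Proof.
by move=> cf x; exact: (continuous_comp (cf x) (@coord_continuous _ _ _ i j _)).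
Qed.

Lemma continuous_sum (R : realType) (T : topologicalType) (I : finType)
    (P : pred I) (f : I -> T -> R) :
  (forall i, P i -> continuous (f i)) ->
  continuous (fun x => \sum_(i | P i) f i x).
Proof. by apply: continuous_big; exact: add_continuous. Qed.

Lemma continuous_sum_mx (R : realType) (T : topologicalType) (I : finType)
    (P : pred I) (m n : nat) (f : I -> T -> 'M[R]_(m, n)) :
  (forall i, P i -> continuous (f i)) ->
  continuous (fun x => \sum_(i | P i) f i x).
Proof.
move=> cf; apply: continuous_mx => a b; under eq_fun do rewrite summxE.
by apply: continuous_sum => i Pi; exact/continuous_coord/cf.
Qed.

Lemma continuous_submxcol (R : realType) (T : topologicalType) (p : nat)
    (r : 'I_p -> nat) i (f : T -> 'cV[R]_(\sum_i r i)) :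
  continuous f -> continuous (fun x => submxcol (f x) i).
Proof.
move=> cf; apply: continuous_mx => a b; under eq_fun do rewrite mxE.
exact: continuous_coord.
Qed.

Lemma continuous_mxcol (R : realType) (T : topologicalType) (p : nat)
    (r : 'I_p -> nat) (f : forall i, T -> 'cV[R]_(r i)) :
  (forall i, continuous (f i)) -> continuous (fun x => \mxcol_i f i x).
Proof.
move=> cf; apply: continuous_mx => a b; under eq_fun do rewrite mxE.
exact: continuous_coord.
Qed.

Lemma continuous_mulmx (R : realType) (T : topologicalType) (m n : nat)
    (A : 'M[R]_(m, n)) (f : T -> 'cV[R]_n) :
  continuous f -> continuous (fun x => A *m f x).
Proof.
move=> cf; apply: continuous_mx => a b; under eq_fun do rewrite mxE.
apply: continuous_sum => k _ x; apply: cvgM; first exact: cvg_cst.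
exact: continuous_coord cf x.
Qed.

Lemma is_derive_mx (R : realType) (V : normedModType R) (m n : nat)
    (f : V -> 'M[R]_(m, n)) (x v : V) (df : 'M[R]_(m, n)) :
  is_derive x v f df <->
  forall i j, is_derive x v (fun y => f y i j) (df i j).
Proof.
split=> [[fx <-] i j|fx].
  apply: DeriveDef; first exact: (derivable_mxP _ _ _).1.
  by rewrite derive_mx// mxE.
have fx' : derivable f x v.
  by apply/derivable_mxP => i j; have [] := fx i j.
apply: DeriveDef => //; rewrite derive_mx//; apply/matrixP => i j.
by rewrite mxE; have [] := fx i j.
Qed.

Lemma bounded_in (R : realType) (T : Type) (V : normedModType R) (A : set T)
    (f : T -> V) (M : R) :
  (forall x, A x -> `|f x| <= M) -> [bounded f x | x in A].
Proof.
move=> fM; rewrite /bounded_near; near=> K => x /= Ax.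
by apply: le_trans (fM _ Ax) _; near: K; apply: nbhs_pinfty_ge; exact: num_real.
Unshelve. all: by end_near. Qed.

Lemma norm_trmx (R : realType) (m n : nat) (A : 'M[R]_(m, n)) : `|A^T| = `|A|.
Proof.
have le p q (B : 'M[R]_(p, q)) : `|B^T| <= `|B|.
  rewrite [leLHS]/Num.Def.normr/= mx_normrE bigmax_le// => -[i j] _.
  rewrite mxE/= [leRHS]/Num.Def.normr/= mx_normrE.
  exact: (le_bigmax _ (fun k => `|B k.1 k.2|) (j, i)).
by apply/le_anti; rewrite le -[in leLHS](trmxK A) le.
Qed.

(** * The Euclidean inner product on column vectors *)

Section dot.
Variables (R : realType) (n : nat).
Implicit Types u v w : 'cV[R]_n.

Lemma dotE u v : dot u v = \sum_k u k 0 * v k 0.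
Proof. by rewrite /dot mxE; apply: eq_bigr => k _; rewrite mxE. Qed.

Lemma dotDl u v w : dot (u + v) w = dot u w + dot v w.
Proof. by rewrite /dot linearD mulmxDl mxE. Qed.

Lemma dotNl u v : dot (- u) v = - dot u v.
Proof. by rewrite /dot linearN mulNmx mxE. Qed.

Lemma dotDr u v w : dot u (v + w) = dot u v + dot u w.
Proof. by rewrite /dot mulmxDr mxE. Qed.

Lemma dotNr u v : dot u (- v) = - dot u v.
Proof. by rewrite /dot mulmxN mxE. Qed.

Lemma dot0l u : dot 0 u = 0.
Proof. by rewrite /dot trmx0 mul0mx mxE. Qed.

Lemma dot_sumr (I : finType) (P : pred I) u (w : I -> 'cV[R]_n) :
  dot u (\sum_(i | P i) w i) = \sum_(i | P i) dot u (w i).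
Proof. by rewrite /dot mulmx_sumr summxE. Qed.

Lemma dot_ge0 u : 0 <= dot u u.
Proof. by rewrite dotE sumr_ge0// => k _; rewrite -expr2 sqr_ge0. Qed.

Lemma dot_eq0 u : (dot u u == 0) = (u == 0).
Proof.
apply/idP/eqP => [|->]; last by rewrite dot0l.
rewrite dotE psumr_eq0 => [/allP u0|k _]; last by rewrite -expr2 sqr_ge0.
apply/colP => k; rewrite mxE; apply/eqP.
by have := u0 k (mem_index_enum _); rewrite mulf_eq0 orbb.
Qed.

(** The norm on matrices is the maximum of the absolute values of the entries,
    whence an inequality here and not an equality. *)
Lemma sqr_norm_le_dot u : `|u| ^+ 2 <= dot u u.
Proof.
have [u0|/mx_norm_neq0[i ui]] := eqVneq (mx_norm u) 0.
  by rewrite [`|u|]u0 expr0n dot_ge0.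
rewrite [`|u|]ui real_normK ?num_real// dotE (bigD1 i.1)//= ord1 -expr2 lerDl.
by rewrite sumr_ge0// => k _; rewrite -expr2 sqr_ge0.
Qed.

(** A bound without square roots: [a <= 1 + a ^+ 2] for every real [a]. *)
Lemma norm_le_dot u : `|u| <= 1 + dot u u.
Proof. by have := sqr_norm_le_dot u; have := sqr_ge0 (`|u| - 1); nra. Qed.

Lemma is_derive_dot (f : R -> 'cV[R]_n) (t : R) (df : 'cV[R]_n) :
  is_derive t 1 f df ->
  is_derive t 1 (fun s => dot (f s) (f s)) (2 * dot (f t) df).
Proof.
move=> /is_derive_mx fdf.
have -> : (fun s => dot (f s) (f s)) = \sum_k (fun s => f s k 0) ^+ 2.
  by apply/funext => s; rewrite fct_sumE dotE; apply: eq_bigr.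
apply: is_derive_eq; rewrite dotE mulr_sumr; apply: eq_bigr => k _.
by rewrite /GRing.scale/= expr1 mulrA.
Qed.

Lemma continuous_dot (T : topologicalType) (f g : T -> 'cV[R]_n) :
  continuous f -> continuous g -> continuous (fun x => dot (f x) (g x)).
Proof.
move=> cf cg.
under eq_fun do rewrite dotE.
apply: continuous_sum => k _ x.
by apply: cvgM; exact: continuous_coord.
Qed.

Definition sqdist (x0 x : 'cV[R]_n) : R := dot (x - x0) (x - x0).

Lemma sqdist_continuous x0 : continuous (sqdist x0).
Proof.
have cB : continuous (fun x : 'cV[R]_n => x - x0).
  move=> x; apply: (continuousB (g := cst x0)); first exact: cvg_id.
  exact: cst_continuous.
exact: (continuous_dot cB cB).
Qed.

Lemma norm_le_sqdist x0 x : `|x| <= `|x0| + (1 + sqdist x0 x).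
Proof.
have := ler_normD x0 (x - x0); rewrite addrC subrK => /le_trans; apply.
by rewrite lerD2l norm_le_dot.
Qed.

End dot.

Lemma dot_mxcol (R : realType) (N : nat) (d : 'I_N -> nat)
    (u v : 'cV[R]_(\sum_i d i)) :
  dot u v = \sum_i dot (submxcol u i) (submxcol v i).
Proof.
rewrite /dot -[in LHS](submxcolK u) -[in LHS](submxcolK v) tr_mxcol.
by rewrite mul_mxrow_mxcol summxE.
Qed.

Lemma dot_mulmxr (R : realType) (m n : nat) (A : 'M[R]_(m, n)) u v :
  dot u (A^T *m v) = dot (A *m u) v.
Proof. by rewrite /dot trmx_mul mulmxA. Qed.

(** * Solutions of dissipative autonomous equations *)

Section dissipative.
Variables (R : realType) (n : nat) (G : 'cV[R]_n -> 'cV[R]_n) (x0 : 'cV[R]_n).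
Variables (T : \bar R) (X : R -> 'cV[R]_n).
Hypothesis G_dissipative : forall x, x != x0 -> dot (x - x0) (G x) < 0.
Hypothesis X_cont : {within lifetime T, continuous X}.
Hypothesis X_deriv : forall t : R, 0 < t -> (t%:E < T)%E ->
  is_derive t 1 X (G (X t)).

(** The mean value theorem covers [s = 0], where [X] is only continuous: it asks
    for continuity on the closed interval and derivatives on the open one. *)
Lemma sqdist_decay (s t m : R) : 0 <= s -> s <= t -> (t%:E < T)%E ->
  (forall r, s < r -> r < t -> dot (X r - x0) (G (X r)) <= - m) ->
  sqdist x0 (X t) <= sqdist x0 (X s) - 2 * m * (t - s).
Proof.
move=> s0; rewrite le_eqVlt => /predU1P[-> _ _|st tT mG].
  by rewrite subrr mulr0 subr0.
pose dV r := 2 * dot (X r - x0) (G (X r)).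
have [||r] := @MVT R (sqdist x0 \o X) dV s t st.
- move=> r; rewrite in_itv/= => /andP[sr rt].
  apply: is_derive_dot.
  have dX : is_derive r 1 X (G (X r)).
    apply: X_deriv; first exact: le_lt_trans sr.
    by apply: lt_trans tT; rewrite lte_fin.
  apply: (is_derive_eq (is_deriveB dX (is_derive_cst x0 r 1))).
  by rewrite subr0.
- have cX : {within `[s, t], continuous X}.
    apply: continuous_subspaceW X_cont => r.
    rewrite /= in_itv/= => /andP[sr rt].
    split; first exact: le_trans sr.
    by apply: le_lt_trans tT; rewrite lee_fin.
  by move=> r; apply: (continuous_comp (cX r)); exact: sqdist_continuous.
- rewrite in_itv/= => /andP[sr rt] /= VE.
  have := mG _ sr rt; set q := dot _ _ in VE * => qm.
  rewrite -lerBlDl VE -mulNr ler_wpM2r//; first by rewrite subr_ge0 ltW.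
  by rewrite -mulrN ler_pM2l.
Qed.

Lemma dissipative_le0 x : dot (x - x0) (G x) <= 0.
Proof.
by have [->|/G_dissipative/ltW//] := eqVneq x x0; rewrite subrr dot0l.
Qed.

Lemma sqdist_nonincreasing (s t : R) : 0 <= s -> s <= t -> (t%:E < T)%E ->
  sqdist x0 (X t) <= sqdist x0 (X s).
Proof.
move=> s0 st tT; rewrite -[leRHS]subr0 -[X in _ - X](mul0r (t - s)).
rewrite -[X in X * _](mulr0 2).
by apply: sqdist_decay => // r _ _; rewrite oppr0 dissipative_le0.
Qed.

Lemma dissipative_bounded : [bounded X t | t in lifetime T].
Proof.
apply: (bounded_in (M := `|x0| + (1 + sqdist x0 (X 0)))) => t [t0 tT].
apply: le_trans (norm_le_sqdist x0 _) _.
by rewrite !lerD2l; exact: sqdist_nonincreasing.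
Qed.

Hypothesis G_cont : continuous G.

(** Unless it is empty, the annulus [eps <= sqdist x0 x <= M] is a compact set on
    which the continuous function [<x0 - x, G x>] attains its minimum; the latter
    is positive because the annulus avoids [x0]. *)
Lemma dissipative_gap (eps M : R) : 0 < eps -> exists2 m, 0 < m &
  forall x, eps <= sqdist x0 x -> sqdist x0 x <= M -> dot (x - x0) (G x) <= - m.
Proof.
move=> eps0.
(* Transposition carries the extreme value theorem from rows to columns. *)
have tr_cont : continuous (trmx : 'rV[R]_n -> 'cV[R]_n).
  apply: continuous_mx => i j; under eq_fun do rewrite mxE.
  exact: coord_continuous.
pose A := [set v : 'rV[R]_n | eps <= sqdist x0 v^T] `&`
  [set v | sqdist x0 v^T <= M].
have [A0|nA0] := pselect (A !=set0); last first.
  exists 1 => // x ex xM; case: nA0; exists x^T.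
  by rewrite /A /= trmxK.
have sq_cont : continuous (fun v : 'rV[R]_n => sqdist x0 v^T).
  by move=> v; apply: (continuous_comp (tr_cont v)); exact: sqdist_continuous.
have A_compact : compact A.
  apply: bounded_closed_compact.
    apply: (bounded_in (M := `|x0| + (1 + M))) => v [_ vM].
    have := norm_le_sqdist x0 v^T; rewrite norm_trmx => /le_trans; apply.
    by rewrite !lerD2l.
  apply: closedI.
  - exact: (@closed_comp _ _ _ [set r | eps <= r] (fun v _ => sq_cont v)
      (@closed_ge _ _)).
  - exact: (@closed_comp _ _ _ [set r | r <= M] (fun v _ => sq_cont v)
      (@closed_le _ _)).
have f_cont : continuous (fun v : 'rV[R]_n => dot (x0 - v^T) (G v^T)).
  apply: continuous_dot => v.
    apply: (continuousB (f := cst x0)); first exact: cst_continuous.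
    exact: tr_cont.
  by apply: (continuous_comp (tr_cont v)); exact: G_cont.
have [c] := EVT_min_rV A0 A_compact (continuous_subspaceT f_cont).
rewrite inE => -[cA _] cmin.
exists (dot (x0 - c^T) (G c^T)); rewrite -opprB dotNl.
  rewrite oppr_gt0 G_dissipative//; apply: contraTneq cA => ->.
  by rewrite /sqdist subrr dot0l -ltNge.
move=> x ex xM; rewrite lerNr.
have := cmin x^T; rewrite trmxK -!(opprB _ x0) !dotNl; apply.
by rewrite inE /A /= trmxK.
Qed.

Lemma dissipative_cvg : T = +oo%E -> X t @[t --> +oo] --> x0.
Proof.
move=> Ty; have ltT t : (t%:E < T)%E by rewrite Ty ltry.
(* As the squared distance is nonincreasing, once small it stays small. *)
suff small (eps : R) : 0 < eps ->
    exists2 t0 : R, 0 <= t0 & sqdist x0 (X t0) < eps.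
  apply/cvgrPdist_lt => eps eps0.
  have [t0 t00 t0eps] := small (eps ^+ 2) (exprn_gt0 _ eps0).
  near=> t.
  rewrite distrC -(ltr_pXn2r (n := 2))// ?nnegrE ?(ltW eps0)//.
  apply: le_lt_trans (sqr_norm_le_dot _) _.
  apply: le_lt_trans t0eps; apply: sqdist_nonincreasing => //.
move=> eps0; apply: contrapT => notsmall.
have big t : 0 <= t -> eps <= sqdist x0 (X t).
  by move=> t0; rewrite leNgt; apply/negP => teps; apply: notsmall; exists t.
have [m m0 gap] := dissipative_gap (sqdist x0 (X 0)) eps0.
(* Decreasing at rate [2 * m], the squared distance would reach [0] within half
   of this time [t], and would be negative at [t]. *)
pose t := sqdist x0 (X 0) / m.
have t0 : 0 <= t by rewrite divr_ge0 ?dot_ge0// ltW.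
have := @sqdist_decay 0 t m (lexx 0) t0 (ltT t).
have -> : 2 * m * (t - 0) = 2 * sqdist x0 (X 0).
  by rewrite subr0 -mulrA [m * _]mulrC divfK// gt_eqF.
have := big t t0; have := big 0 (lexx 0).
move=> e1 e2 decay.
suff : sqdist x0 (X t) <= sqdist x0 (X 0) - 2 * sqdist x0 (X 0) by lra.
apply: decay => r r0 _; apply: gap; first by rewrite big// ltW.
by rewrite sqdist_nonincreasing// ltW.
Unshelve. all: by end_near. Qed.
End dissipative.

(** * Equilibria and the estimate dynamics *)

Section game.
Variables (R : realType) (N : nat) (d : 'I_N -> nat).
Variables (J : 'I_N -> profile R d -> R) (e : rel 'I_N).

(** Moving along a partial direction used in [grad] is a unilateral deviation of
    player [i], to which the Nash inequality applies. *)
Lemma deviate_line (x : profile R d) i k (s : R) :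
  s *: ((sel R d i)^T *m delta_mx k 0) + x =
  deviate x (action x i + s *: delta_mx k 0).
Proof.
apply/mxcolP => j; rewrite /deviate mxcolK.
have selE : (sel R d i)^T *m delta_mx k 0 =
    delta_mx (tagnat.Rank i k) 0 :> profile R d.
  by rewrite -colE; apply/colP => a; rewrite !mxE andbT eq_sym.
rewrite selE; case: dfwithP => [|{}j iNj]; apply/colP => a; rewrite !mxE.
  by rewrite -val_eqE tagnat.eq_Rank eqxx/= andbT addrC.
by rewrite -val_eqE tagnat.eq_Rank eq_sym (negbTE iNj) mulr0 add0r.
Qed.

(** Fermat's rule, along each coordinate of each player's action. *)
Lemma grad_nash (xs : profile R d) i :
  (forall x, differentiable (J i) x) -> nash J xs -> grad J i xs = 0.
Proof.
move=> dJ xs_nash; apply/colP => k; rewrite !mxE.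
set v := _ *m _.
pose f (s : R) := J i (s *: v + xs).
have f_derivable s : derivable f s 1.
  by apply/derivable1_diffP; exact: differentiable_comp.
have f_min (s : R) : f 0 <= f s.
  by rewrite /f scale0r add0r deviate_line; exact: xs_nash.
have f0 : is_derive (0 : R) 1 f 0.
  apply: (@derive1_at_min R f (-1) 1 0) => //.
  by rewrite in_itv/= ltrN10 ltr01.
rewrite -(derive_val (is_derive := f0)) /derive.
suff -> : (fun h => h^-1 *: (J i (h *: v + xs) - J i xs)) =
    (fun h => h^-1 *: ((f \o shift 0) (h *: 1) - f 0)) by [].
apply/funext => h /=.
by rewrite /f addr0 scale0r add0r [h%:A]mulr1.
Qed.

(** Stacked player by player, which is the form in which [solution] specifies the
    derivative of the estimates. *)
Definition field (X : estimates R N d) : estimates R N d :=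
  \mxcol_i player_field J e X i.

Lemma grad_continuous i : C1 (J i) -> continuous (grad J i).
Proof.
move=> [_ dJ]; apply: continuous_mx => k j.
rewrite [X in continuous X](_ : _ =
  (fun x => 'D_((sel R d i)^T *m delta_mx k 0) (J i) x)); first exact: dJ.
by apply/funext => x; rewrite mxE.
Qed.

Lemma player_field_continuous i :
  (forall i, C1 (J i)) ->
  continuous (fun X : estimates R N d => player_field J e X i).
Proof.
move=> J_C1 X.
have est_cont j : continuous (fun X : estimates R N d => estimate X j).
  by apply: continuous_submxcol => Y; exact: cvg_id.
have grad_cont : continuous (fun X : estimates R N d =>
    (sel R d i)^T *m grad J i (estimate X i)).
  apply: continuous_mulmx => Y; apply: (continuous_comp (est_cont i Y)).
  exact: grad_continuous.
have sum_cont : continuous (fun X : estimates R N d =>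
    \sum_(j | e i j) (estimate X i - estimate X j)).
  apply: continuous_sum_mx => j _ Y.
  exact: (continuousB (est_cont i Y) (est_cont j Y)).
exact: (continuousB (continuousN (grad_cont X)) (sum_cont X)).
Qed.

Lemma field_continuous : (forall i, C1 (J i)) -> continuous field.
Proof.
by move=> J_C1; apply: continuous_mxcol => i; exact: player_field_continuous.
Qed.

Lemma solution_is_derive (T : \bar R) (X : R -> estimates R N d) (t : R) :
  solution J e T X -> 0 < t -> (t%:E < T)%E -> is_derive t 1 X (field (X t)).
Proof.
move=> [_ Xd] t0 tT; apply/is_derive_mx => a b; rewrite /field mxE.
have := (is_derive_mx _ _ _ _).1 (Xd t t0 tT (tagnat.sig1 a)) (tagnat.sig2 a) b.
by under eq_fun do rewrite mxE tagnat.sig2K.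
Qed.

Hypothesis e_sym : symmetric e.

(** The quadratic form [2 X^T L X] of the Laplacian: each undirected edge is
    counted twice. *)
Definition disagreement (X : estimates R N d) : R :=
  \sum_i \sum_(j | e i j)
    dot (estimate X i - estimate X j) (estimate X i - estimate X j).

(** Exchanging the ends of the edges and averaging makes the reference profile
    [x] cancel. *)
Lemma disagreementE (x : profile R d) X :
  \sum_i dot (estimate X i - x)
             (\sum_(j | e i j) (estimate X i - estimate X j)) =
  disagreement X / 2.
Proof.
pose D i j := dot (estimate X i - x) (estimate X i - estimate X j).
have sumD : \sum_i dot (estimate X i - x)
    (\sum_(j | e i j) (estimate X i - estimate X j)) =
    \sum_i \sum_(j | e i j) D i j.
  by apply: eq_bigr => i _; rewrite dot_sumr.
have sumDC : \sum_i \sum_(j | e i j) D i j = \sum_i \sum_(j | e i j) D j i.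
  rewrite (exchange_big_dep predT)//=; apply: eq_bigr => i _.
  by apply: eq_bigl => j; rewrite e_sym.
suff -> : disagreement X =
    \sum_i \sum_(j | e i j) D i j + \sum_i \sum_(j | e i j) D j i.
  by rewrite -sumDC sumD; lra.
rewrite -big_split; apply: eq_bigr => i _.
rewrite -big_split; apply: eq_bigr => j _.
rewrite /= /D -(opprB (estimate X i) (estimate X j)) dotNr -dotNl -dotDl.
by rewrite opprB addrA subrK.
Qed.

Lemma disagreement_ge0 X : 0 <= disagreement X.
Proof.
by rewrite sumr_ge0// => i _; rewrite sumr_ge0// => j _; exact: dot_ge0.
Qed.

Lemma disagreement_eq0 X i j : (forall i j, connect e i j) ->
  disagreement X = 0 -> estimate X i = estimate X j.
Proof.
move=> e_conn /eqP; rewrite psumr_eq0 => [/allP X0|k _]; last first.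
  by rewrite sumr_ge0// => l _; exact: dot_ge0.
have edge k l : e k l -> estimate X k = estimate X l.
  move=> ekl; have := X0 k (mem_index_enum _).
  rewrite psumr_eq0 => [/allP/(_ l (mem_index_enum _))|m _]; last first.
    exact: dot_ge0.
  by rewrite ekl dot_eq0 subr_eq0 => /eqP.
have /connectP[p] := e_conn i j.
by elim: p i => [i _ ->//|k p IH i /= /andP[/edge -> /IH H]] /H.
Qed.

Lemma action_bsel X i : action (bsel R d *m X) i = action (estimate X i) i.
Proof.
rewrite /action /bsel -[in LHS](submxcolK X) mul_mxblock_mxrow mxcolK.
rewrite (bigD1 i)//= eqxx scale1r mul_sel [X in _ + X]big1 ?addr0// => j.
by rewrite eq_sym => /negbTE ->; rewrite scale0r mul0mx.
Qed.

Lemma estimate_consensus (x : profile R d) i :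
  estimate (\mxcol_(i < N) x) i = x.
Proof. exact: mxcolK. Qed.

Lemma bsel_consensus (x : profile R d) : bsel R d *m \mxcol_i x = x.
Proof.
by apply/mxcolP => i; rewrite -!/(action _ i) action_bsel estimate_consensus.
Qed.

Lemma ext_pseudo_grad_consensus (x : profile R d) :
  ext_pseudo_grad J (\mxcol_i x) = pseudo_grad J x.
Proof. by apply/eq_mxcolP => i; rewrite estimate_consensus. Qed.

(** The equilibrium enters through its vanishing gradients, which let
    [ext_pseudo_grad J (\mxcol_i xs)] be subtracted at no cost. *)
Lemma dot_field (xs : profile R d) X :
  (forall i, grad J i xs = 0) ->
  dot (X - \mxcol_i xs) (field X) =
  - (dot (bsel R d *m X - bsel R d *m \mxcol_i xs)
         (ext_pseudo_grad J X - ext_pseudo_grad J (\mxcol_i xs))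
     + disagreement X / 2).
Proof.
move=> grad0; rewrite -(disagreementE xs) !dot_mxcol -big_split -sumrN.
apply: eq_bigr => i _; rewrite submxcolB !mxcolK -/(estimate X i) /player_field.
rewrite dotDr !dotNr dot_mulmxr opprD; congr (- _ - _).
rewrite mulmxBr !mul_sel !submxcolB; congr dot.
  by rewrite -!/(action _ i) !action_bsel estimate_consensus.
by rewrite !mxcolK estimate_consensus grad0 subr0.
Qed.

(** A vanishing derivative forces consensus, by connectedness, and then a
    consensus on [xs], by strict monotonicity. *)
Lemma field_dissipative (xs : profile R d) X :
  (forall i j, connect e i j) ->
  (forall x x' : profile R d, x != x' ->
     0 < dot (x - x') (pseudo_grad J x - pseudo_grad J x')) ->
  (forall X X' : estimates R N d,
     0 <= dot (bsel R d *m X - bsel R d *m X')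
              (ext_pseudo_grad J X - ext_pseudo_grad J X')) ->
  (forall i, grad J i xs = 0) ->
  X != \mxcol_i xs -> dot (X - \mxcol_i xs) (field X) < 0.
Proof.
move=> e_conn F_strict F_mono grad0 Xxs.
rewrite dot_field// oppr_lt0 lt_neqAle addr_ge0 ?F_mono ?divr_ge0//
  ?disagreement_ge0// andbT eq_sym paddr_eq0 ?F_mono ?divr_ge0//
  ?disagreement_ge0//.
apply/negP => /andP[/eqP F0].
rewrite mulf_eq0 invr_eq0 pnatr_eq0 orbF => /eqP D0.
have [i Xi] : exists i, estimate X i != xs.
  apply/existsP; apply: contraNT Xxs => /existsPn X_xs.
  by apply/eqP/mxcolP => i; rewrite mxcolK; apply/eqP/negPn/X_xs.
have XE : X = \mxcol_j estimate X i.
  by apply/mxcolP => j; rewrite mxcolK; exact: disagreement_eq0.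
have := F_strict _ _ Xi.
(* Strict monotonicity on profiles is read as a statement on consensus
   estimates, one of which is [X] itself. *)
rewrite -(ext_pseudo_grad_consensus xs).
rewrite -(ext_pseudo_grad_consensus (estimate X i)).
rewrite -[X in dot (X - _)](bsel_consensus (estimate X i)).
rewrite -[X in dot (_ - X)](bsel_consensus xs) -XE.
by rewrite F0 ltxx.
Qed.

End game.

Theorem theorem1 (R : realType) (N : nat) (d : 'I_N -> nat)
    (J : 'I_N -> profile R d -> R) (e : rel 'I_N)
    (e_sym : symmetric e) (e_irr : irreflexive e)
    (e_conn : forall i j : 'I_N, connect e i j)
    (J_C2 : forall i : 'I_N, C2 (J i))
    (J_convex : forall (i : 'I_N) (x : profile R d),
       strictly_convex (fun y : 'cV[R]_(d i) => J i (deviate x y)))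
    (J_unbounded : forall (i : 'I_N) (x : profile R d),
       radially_unbounded (fun y : 'cV[R]_(d i) => J i (deviate x y)))
    (F_strict : forall x x' : profile R d, x != x' ->
       0 < dot (x - x') (pseudo_grad J x - pseudo_grad J x'))
    (F_ext_mono : forall X X' : estimates R N d,
       0 <= dot (bsel R d *m X - bsel R d *m X')
                (ext_pseudo_grad J X - ext_pseudo_grad J X'))
    (xs : profile R d) (xs_nash : nash J xs)
    (T : \bar R) (T_gt0 : (0 < T)%E)
    (X : R -> estimates R N d) (X_sol : solution J e T X) :
  [bounded X t | t in lifetime T] /\
  (T = +oo%E ->
     X t @[t --> +oo] --> (\mxcol_(i < N) xs : estimates R N d) /\
     bsel R d *m X t @[t --> +oo] --> xs).
Proof.
have grad0 i : grad J i xs = 0.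
  by apply: grad_nash xs_nash; exact: (J_C2 i).1.1.
have dissip (Y : estimates R N d) : Y != \mxcol_(i < N) xs ->
    dot (Y - \mxcol_(i < N) xs) (field J e Y) < 0.
  exact: field_dissipative.
have X_deriv t : 0 < t -> (t%:E < T)%E -> is_derive t 1 X (field J e (X t)).
  exact: solution_is_derive.
split; first exact: (dissipative_bounded dissip X_sol.1 X_deriv).
move=> Ty.
have X_cvg : X t @[t --> +oo] --> (\mxcol_(i < N) xs : estimates R N d).
  apply: (dissipative_cvg dissip X_sol.1 X_deriv _ Ty).
  by apply: field_continuous => i; exact: (J_C2 i).1.
split=> //; rewrite -[X in _ --> X]bsel_consensus.
apply: (continuous_cvg _ _ X_cvg).
by apply: continuous_mulmx => Y; exact: cvg_id.
Qed.
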